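(* Let $\alpha_i\ge 0$, $\beta_i>0$ ($1\le i\le 5$) and $Q>0$ be real numbers, and consider the networks $N$ and $N^+$ with these parameters and total flow $Q$. Suppose that at equilibria $N$ has no path with vanishing flow and $P_2$ is the only path with vanishing flow in $N^+$. Then Braess' paradox occurs in $N/N^+$ (i.e. $T^+_{Eq}>T_{Eq}$) if and only if $\mathcal B_4>0$ and $$\max\left\{\frac{\alpha}{\beta_{12}},\ \frac{-\alpha}{\beta_{45}},\ \frac{\hat\alpha}{\beta_{35}},\ \frac{-\hat\alpha}{\beta_2},\ \frac{\hat\alpha\beta_2\beta+\alpha\beta_{235}\beta_{12}}{\mathcal B_4}\right\} < Q \le \mu_2.$$
   Context: The network $N^+$ has nodes $a,b,c,d$ and directed links $(a,b),(b,d),(b,c),(a,c),(c,d)$ with travel times $\alpha_1+\beta_1f_{ab}$, $\alpha_2+\beta_2f_{bd}$, $\alpha_3+\beta_3f_{bc}$, $\alpha_4+\beta_4f_{ac}$, $\alpha_5+\beta_5f_{cd}$ respectively, where $f_{ij}\ge 0$ is the (real) flow on link $(i,j)$ and $\alpha_i\ge 0$, $\beta_i>0$. All traffic, of total amount $Q>0$ (real), goes from $a$ to $d$ along the paths $P_1=a-b-d$, $P_2=a-c-d$, $P_3=a-b-c-d$. The network $N$ is $N^+$ with the link $(b,c)$ removed, so its paths are $P_1,P_2$ only. A flow assigns a non-negative real amount to each path, with total $Q$; the flow on a link is the sum of the flows of the paths containing it; the travel time on a path is the sum of the travel times of its links. A path has vanishing flow if its path flow is $0$, and non-vanishing flow otherwise.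 A network is at equilibrium if all paths with non-vanishing flow have the same travel time, and every path with vanishing flow has travel time at least this common value. The equilibrium exists and is unique; its common travel time is denoted $T_{Eq}$ for $N$ and $T^+_{Eq}$ for $N^+$. Braess' paradox is said to occur in $N/N^+$ for the total flow $Q$ if $T^+_{Eq}>T_{Eq}$. Notation: multiple indices denote sums, e.g. $\alpha_{ij}=\alpha_i+\alpha_j$, $\beta_{235}=\beta_2+\beta_3+\beta_5$. Further, $\alpha=\alpha_{45}-\alpha_{12}$, $\bar\alpha=\alpha_4-\alpha_{13}$, $\hat\alpha=\alpha_2-\alpha_{35}$, $\beta=\beta_1+\beta_2+\beta_4+\beta_5$, $\mathcal B_4=\beta_{12}^2\beta_{235}-\beta_2^2\beta$, and $$\mu_2=\frac{\bar\alpha\beta_{25}+\alpha\beta_3}{\beta_1\beta_{25}+\beta_3\beta_{12}}.$$ *)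

(* Defs.v *)
From HB Require Import structures.
From mathcomp Require Import all_boot all_order all_algebra.
From mathcomp Require Import classical_sets reals.

Set Implicit Arguments.
Unset Strict Implicit.
Unset Printing Implicit Defensive.

Import Order.TTheory GRing.Theory Num.Theory.

Local Open Scope ring_scope.

Inductive node := node_a | node_b | node_c | node_d.

Definition node_eqb (x y : node) : bool :=
  match x, y with
  | node_a, node_a | node_b, node_b | node_c, node_c | node_d, node_d => true
  | _, _ => false
  end.

Lemma node_eqP : Equality.axiom node_eqb.
Proof. by do 2![case]; constructor. Qed.

HB.instance Definition _ := hasDecEq.Build node node_eqP.

Definition link : Type := (node * node)%type.

(* A path is the sequence of the nodes it visits. *)
Definition P1 : seq node := [:: node_a; node_b; node_d].
Definition P2 : seq node := [:: node_a; node_c; node_d].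
Definition P3 : seq node := [:: node_a; node_b; node_c; node_d].

Definition path_links (p : seq node) : seq (node * node) := zip p (behead p).

Record network (R : realType) := Network {
  links : seq (node * node);
  link_time : link -> R -> R
}.

(* Meant for subnetworks of Nplus, whose only paths from a to d are P1, P2, P3. *)
Definition paths (R : realType) (net : network R) : seq (seq node) :=
  [seq p <- [:: P1; P2; P3] | all (mem (links net)) (path_links p)].

Definition remove_link (R : realType) (e : link) (net : network R) :
    network R :=
  Network (rem e (links net)) (link_time net).

(* The coefficients are indexed from 1 to 5, in the order of this list; the   *)
(* values of alpha and beta at other indices play no role.                    *)
Definition Nplus_links : seq (node * node) :=
  [:: (node_a, node_b); (node_b, node_d); (node_b, node_c);
      (node_a, node_c); (node_c, node_d)].

Definition Nplus (R : realType) (alpha beta : nat -> R) : network R :=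
  Network Nplus_links
    (fun e x => let i := (index e Nplus_links).+1 in alpha i + beta i * x).

Definition N (R : realType) (alpha beta : nat -> R) : network R :=
  remove_link (node_b, node_c) (Nplus alpha beta).

(* A flow on net is represented by a function on all node sequences, of which *)
(* only the values on the paths of net are ever used.                         *)
Definition is_flow (R : realType) (net : network R) (Q : R)
    (f : seq node -> R) : Prop :=
  (forall p, p \in paths net -> 0 <= f p) /\ \sum_(p <- paths net) f p = Q.

Definition link_flow (R : realType) (net : network R) (f : seq node -> R)
    (e : link) : R :=
  \sum_(p <- paths net | e \in path_links p) f p.

Definition path_time (R : realType) (net : network R) (f : seq node -> R)
    (p : seq node) : R :=
  \sum_(e <- path_links p) link_time net e (link_flow net f e).

Definition vanishing (R : realType) (f : seq node -> R) (p : seq node) : Prop :=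
  f p = 0.

(* For Q > 0 some path has non-vanishing flow, so f determines T.             *)
Definition equilibrium_at (R : realType) (net : network R) (Q : R)
    (f : seq node -> R) (T : R) : Prop :=
  is_flow net Q f /\
  forall p, p \in paths net ->
    (~ vanishing f p -> path_time net f p = T) /\
    (vanishing f p -> T <= path_time net f p).

Definition equilibrium (R : realType) (net : network R) (Q : R)
    (f : seq node -> R) : Prop :=
  exists T, equilibrium_at net Q f T.

(* The default value 0 of xget is taken only if net has no equilibrium.       *)
Definition T_Eq (R : realType) (net : network R) (Q : R) : R :=
  xget 0 [set T | exists f, equilibrium_at net Q f T]%classic.

Definition braess_paradox (R : realType) (alpha beta : nat -> R) (Q : R) :
    Prop :=
  T_Eq (Nplus alpha beta) Q > T_Eq (N alpha beta) Q.

Definition alpha_diff (R : realType) (alpha : nat -> R) : R :=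
  (alpha 4%N + alpha 5%N) - (alpha 1%N + alpha 2%N).

Definition alpha_bar (R : realType) (alpha : nat -> R) : R :=
  alpha 4%N - (alpha 1%N + alpha 3%N).

Definition alpha_hat (R : realType) (alpha : nat -> R) : R :=
  alpha 2%N - (alpha 3%N + alpha 5%N).

Definition beta_sum (R : realType) (beta : nat -> R) : R :=
  beta 1%N + beta 2%N + beta 4%N + beta 5%N.

Definition B4 (R : realType) (beta : nat -> R) : R :=
  (beta 1%N + beta 2%N) ^+ 2 * (beta 2%N + beta 3%N + beta 5%N)
  - beta 2%N ^+ 2 * beta_sum beta.

Definition mu2 (R : realType) (alpha beta : nat -> R) : R :=
  (alpha_bar alpha * (beta 2%N + beta 5%N) + alpha_diff alpha * beta 3%N)
  / (beta 1%N * (beta 2%N + beta 5%N) + beta 3%N * (beta 1%N + beta 2%N)).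

(* Main.v *)
(** Writing y for the equilibrium flow of P2 in N and g for that of P3 in N+,
    the equilibrium equations turn T+ > T into beta_12 y > beta_2 g, and turn
    the condition that the unused path P2 of N+ is not faster into
    beta_25 g >= beta y.  Eliminating y and g from these two gives
    beta_12 beta_25 > beta_2 beta, whence B4 > 0; the remaining bounds on Q are
    the positivity of the path flows and these two inequalities, solved for Q.
    Equilibrium times are unique by monotonicity: the total cost of f at the
    travel times of f is at most that of any other flow g, so adding the
    inequalities for (f, g) and (g, f) shows that the link flows coincide. *)

Require Import Defs.
From mathcomp Require Import all_boot all_order all_algebra reals.
From mathcomp Require Import classical_sets ring lra.

Set Implicit Arguments.
Unset Strict Implicit.

Import Order.TTheory GRing.Theory Num.Theory.

Local Open Scope ring_scope.

Lemma paths_links_uniq (R : realType) (net : network R) p :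
  p \in paths net -> uniq (path_links p).
Proof.
by rewrite mem_filter !inE => /andP[_] /or3P[] /eqP->.
Qed.

Lemma paths_links_sub (R : realType) (net : network R) p :
  p \in paths net -> {subset path_links p <= links net}.
Proof. by rewrite mem_filter => /andP[/allP]. Qed.

(** Double counting over pairs of a path and a link on it. Times come from [f] and amounts from [g],
    so that two equilibria can be compared; the right side sees the flows only through their link
    flows. *)
Lemma sum_path_time (R : realType) (net : network R) (f g : seq node -> R) :
  uniq (links net) ->
  \sum_(p <- paths net) path_time net f p * g p =
  \sum_(e <- links net) link_time net e (link_flow net f e) * link_flow net g e.
Proof.
move=> ul.
under [RHS]eq_bigr do rewrite /link_flow mulr_sumr.
rewrite (exchange_big_dep xpredT) //= big_seq [RHS]big_seq.
apply: eq_bigr => p pnet; rewrite mulr_suml -[RHS]big_filter.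
apply: perm_big; apply: uniq_perm.
- exact: paths_links_uniq pnet.
- exact: filter_uniq.
- move=> e; rewrite mem_filter andb_idr //; exact: paths_links_sub pnet e.
Qed.

Lemma equilibrium_cost (R : realType) (net : network R) Q f T :
  equilibrium_at net Q f T ->
  \sum_(p <- paths net) path_time net f p * f p = T * Q.
Proof.
move=> [[_ <-] eqf]; rewrite mulr_sumr big_seq [RHS]big_seq.
apply: eq_bigr => p /eqf[used _].
by have [->|/eqP /used->//] := eqVneq (f p) 0; rewrite !mulr0.
Qed.

(** No path is faster than [T] at the times set by [f], so no rerouting of the total [Q] costs less
    than [T * Q]. *)
Lemma equilibrium_cost_le (R : realType) (net : network R) Q f T g :
  equilibrium_at net Q f T -> is_flow net Q g ->
  T * Q <= \sum_(p <- paths net) path_time net f p * g p.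
Proof.
move=> [_ eqf] [g0 <-]; rewrite mulr_sumr big_seq [leRHS]big_seq.
apply: ler_sum => p pnet; apply: ler_wpM2r; first exact: g0.
have [used unused] := eqf p pnet.
by have [/unused//|/eqP /used->] := eqVneq (f p) 0.
Qed.

Lemma equilibrium_time_unique (R : realType) (net : network R) Q f T g U :
  uniq (links net) ->
  (forall e, e \in links net -> {homo link_time net e : x y / x < y}) ->
  0 < Q -> equilibrium_at net Q f T -> equilibrium_at net Q g U -> T = U.
Proof.
move=> ul incr Q0 eqf eqg.
(* Strict monotonicity makes both factors have the same sign, and vanish together. *)
have mono e : e \in links net -> forall x y : R,
    0 <= (link_time net e x - link_time net e y) * (x - y) ?= iff (x == y).
  move=> /incr /le_mono he x y; split.
    have [xy|xy|->] := ltgtP x y; last by rewrite !subrr mulr0.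
    - by apply: mulr_le0; rewrite subr_le0 ?he ltW.
    - by apply: mulr_ge0; rewrite subr_ge0 ?he ltW.
  by rewrite eq_sym mulf_eq0 !subr_eq0 (inj_eq (inc_inj he)) orbb.
pose D e := (link_time net e (link_flow net f e)
  - link_time net e (link_flow net g e)) * (link_flow net f e - link_flow net g e).
have D0 e : e \in links net -> 0 <= D e by move=> /mono h; rewrite /D h.
have sumD : \sum_(e <- links net) D e = 0.
  apply/eqP; rewrite eq_le; apply/andP; split; last first.
    by rewrite big_seq; apply: sumr_ge0.
  (* The sum of the [D e] is the two equilibrium costs minus the two crossed costs, hence at most
     0. *)
  have := equilibrium_cost_le eqf (proj1 eqg).
  have := equilibrium_cost_le eqg (proj1 eqf).
  rewrite -(equilibrium_cost eqf) -(equilibrium_cost eqg) !sum_path_time //.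
  under [X in _ -> _ -> X <= _]eq_bigr do rewrite /D mulrBl !mulrBr opprB addrA.
  rewrite !big_split /= !sumrN; lra.
have same e : e \in links net -> link_flow net f e = link_flow net g e.
  move=> el; apply/eqP; rewrite -(mono e el) eq_sym.
  have /eqP := sumD; rewrite big_seq psumr_eq0 // => /allP/(_ e el).
  by rewrite el.
(* [T * Q] and [U * Q] are total costs, which depend on link flows alone. *)
apply: (mulIf (lt0r_neq0 Q0)).
rewrite -(equilibrium_cost eqf) -(equilibrium_cost eqg) !sum_path_time //.
by rewrite big_seq [RHS]big_seq; apply: eq_bigr => e el; rewrite same.
Qed.

Lemma T_EqE (R : realType) (net : network R) Q f T :
  uniq (links net) ->
  (forall e, e \in links net -> {homo link_time net e : x y / x < y}) ->
  0 < Q -> equilibrium_at net Q f T -> T_Eq net Q = T.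
Proof.
move=> ul incr Q0 eqf.
have [g eqg] : [set T | exists f, equilibrium_at net Q f T]%classic (T_Eq net Q).
  by apply: xgetPex; exists T, f.
exact: equilibrium_time_unique eqg eqf.
Qed.

Lemma Nplus_link_time_increasing (R : realType) (alpha beta : nat -> R) e :
  (forall i, (1 <= i <= 5)%N -> 0 < beta i) -> e \in Nplus_links ->
  {homo link_time (Nplus alpha beta) e : x y / x < y}.
Proof.
move=> hbeta el x y xy.
have b0 : 0 < beta (index e Nplus_links).+1.
  (* [index] counts from 0, so its successor lies between 1 and 5. *)
  by apply: hbeta; rewrite ltn0Sn -[5%N]/(size Nplus_links) index_mem.
by rewrite /Nplus /link_time ltrD2l ltr_pM2l.
Qed.

Lemma N_equilibriumE (R : realType) (alpha beta : nat -> R) Q f T :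
  equilibrium_at (N alpha beta) Q f T -> f P1 <> 0 -> f P2 <> 0 ->
  [/\ 0 < f P1, 0 < f P2, f P1 + f P2 = Q,
      T = alpha 1%N + alpha 2%N + (beta 1%N + beta 2%N) * f P1 &
      T = alpha 4%N + alpha 5%N + (beta 4%N + beta 5%N) * f P2].
Proof.
(* The filter defining [paths] computes, so the explicit list holds by conversion. *)
have -> : equilibrium_at (N alpha beta) Q f T =
  (((forall p, p \in [:: P1; P2] -> 0 <= f p) /\ \sum_(p <- [:: P1; P2]) f p = Q)
  /\ forall p, p \in [:: P1; P2] ->
    (~ vanishing f p -> path_time (N alpha beta) f p = T) /\
    (vanishing f p -> T <= path_time (N alpha beta) f p)) by [].
move=> [[f0 fQ] eqf] /eqP n1 /eqP n2.
have m1 : P1 \in [:: P1; P2] by [].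
have m2 : P2 \in [:: P1; P2] by [].
have := proj1 (eqf _ m1) (elimN eqP n1); have := proj1 (eqf _ m2) (elimN eqP n2).
have -> : path_time (N alpha beta) f P1 =
    \sum_(e <- path_links P1) link_time (Nplus alpha beta) e
      (\sum_(p <- [:: P1; P2] | e \in path_links p) f p) by [].
have -> : path_time (N alpha beta) f P2 =
    \sum_(e <- path_links P2) link_time (Nplus alpha beta) e
      (\sum_(p <- [:: P1; P2] | e \in path_links p) f p) by [].
rewrite !(big_cons, big_nil) /= in fQ *.
move=> t2 t1; split; rewrite ?lt0r ?n1 ?n2 ?f0 //; lra.
Qed.

(** With [P2] empty, the link from a to b carries all of [Q], the link from a to c nothing, and the
    link from c to d only the flow of [P3]. *)
Lemma Nplus_equilibriumE (R : realType) (alpha beta : nat -> R) Q f T :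
  equilibrium_at (Nplus alpha beta) Q f T -> f P1 <> 0 -> f P2 = 0 -> f P3 <> 0 ->
  [/\ 0 < f P1, 0 < f P3, f P1 + f P3 = Q &
  [/\ T = alpha 1%N + alpha 2%N + beta 1%N * Q + beta 2%N * f P1,
      T = alpha 1%N + alpha 3%N + alpha 5%N + beta 1%N * Q
          + (beta 3%N + beta 5%N) * f P3 &
      T <= alpha 4%N + alpha 5%N + beta 5%N * f P3]].
Proof.
have -> : equilibrium_at (Nplus alpha beta) Q f T =
  (((forall p, p \in [:: P1; P2; P3] -> 0 <= f p)
    /\ \sum_(p <- [:: P1; P2; P3]) f p = Q)
  /\ forall p, p \in [:: P1; P2; P3] ->
    (~ vanishing f p -> path_time (Nplus alpha beta) f p = T) /\
    (vanishing f p -> T <= path_time (Nplus alpha beta) f p)) by [].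
move=> [[f0 fQ] eqf] /eqP n1 z2 /eqP n3.
have m1 : P1 \in [:: P1; P2; P3] by [].
have m2 : P2 \in [:: P1; P2; P3] by [].
have m3 : P3 \in [:: P1; P2; P3] by [].
have := proj1 (eqf _ m1) (elimN eqP n1); have := proj2 (eqf _ m2) z2.
have := proj1 (eqf _ m3) (elimN eqP n3).
have E p : path_time (Nplus alpha beta) f p =
    \sum_(e <- path_links p) link_time (Nplus alpha beta) e
      (\sum_(p <- [:: P1; P2; P3] | e \in path_links p) f p) by [].
rewrite !E !(big_cons, big_nil) /= z2 in fQ *.
move=> t3 t2 t1.
have g1Q : f P1 = Q - f P3 by lra.
split; rewrite ?lt0r ?n1 ?n3 ?f0 //; first lra.
rewrite g1Q in t1 t2 t3 *; split; lra.
Qed.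

Theorem theorem4 (R : realType) (alpha beta : nat -> R) (Q : R)
    (halpha : forall i : nat, (1 <= i <= 5)%N -> 0 <= alpha i)
    (hbeta : forall i : nat, (1 <= i <= 5)%N -> 0 < beta i)
    (hQ : 0 < Q)
    (f fplus : seq node -> R)
    (hf : equilibrium (N alpha beta) Q f)
    (hfplus : equilibrium (Nplus alpha beta) Q fplus)
    (hN : forall p, p \in paths (N alpha beta) -> ~ vanishing f p)
    (hNplus : forall p, p \in paths (Nplus alpha beta) ->
                (vanishing fplus p <-> p = P2)) :
  braess_paradox alpha beta Q <->
  0 < B4 beta /\
  Num.max (alpha_diff alpha / (beta 1%N + beta 2%N))
    (Num.max (- alpha_diff alpha / (beta 4%N + beta 5%N))
      (Num.max (alpha_hat alpha / (beta 3%N + beta 5%N))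
        (Num.max (- alpha_hat alpha / beta 2%N)
          ((alpha_hat alpha * beta 2%N * beta_sum beta
            + alpha_diff alpha * (beta 2%N + beta 3%N + beta 5%N)
              * (beta 1%N + beta 2%N)) / B4 beta)))) < Q <= mu2 alpha beta.
Proof.
case: hf => T eqf; case: hfplus => U eqfplus.
have incr e := @Nplus_link_time_increasing R alpha beta e hbeta.
rewrite /braess_paradox (T_EqE _ _ hQ eqf) //; last first.
  by move=> e /mem_rem; apply: incr.
rewrite (T_EqE _ _ hQ eqfplus) //.
have [] := N_equilibriumE eqf (hN P1 isT) (hN P2 isT).
have n1 : fplus P1 <> 0 by move=> /(hNplus P1 isT).
have z2 : fplus P2 = 0 by apply/(hNplus P2 isT).
have n3 : fplus P3 <> 0 by move=> /(hNplus P3 isT).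
have [] := Nplus_equilibriumE eqfplus n1 z2 n3.
have b1 := hbeta 1%N isT; have b2 := hbeta 2%N isT; have b3 := hbeta 3%N isT.
have b4 := hbeta 4%N isT; have b5 := hbeta 5%N isT.
(* What remains is real arithmetic: [g1], [g] are the flows of [P1], [P3] in the larger network, and
   [x], [y] those of [P1], [P2] in the smaller one. *)
move: (fplus P1) (fplus P3) (f P1) (f P2) b1 b2 b3 b4 b5 => g1 g x y.
rewrite /B4 /mu2 /alpha_diff /alpha_hat /alpha_bar /beta_sum.
move: (beta 1%N) (beta 2%N) (beta 3%N) (beta 4%N) (beta 5%N) => c1 c2 c3 c4 c5.
move: (alpha 1%N) (alpha 2%N) (alpha 3%N) (alpha 4%N) (alpha 5%N).
move=> a1 a2 a3 a4 a5 c1_gt0 c2_gt0 c3_gt0 c4_gt0 c5_gt0.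
move=> g1_gt0 g_gt0 gQ [U1 U3 U2] x_gt0 y_gt0 xyQ T1 T2.
have Dy : a4 + a5 - (a1 + a2) = (c1 + c2) * x - (c4 + c5) * y by lra.
have Dg : a2 - (a3 + a5) = (c3 + c5) * g - c2 * g1 by lra.
(* This uses that [alpha_bar] is the sum of [alpha_diff] and [alpha_hat]. *)
have Dbar : (a4 - (a1 + a3)) * (c2 + c5) + (a4 + a5 - (a1 + a2)) * c3 =
    (a4 + a5 - (a1 + a2)) * (c2 + c3 + c5) + (a2 - (a3 + a5)) * (c2 + c5).
  by ring.
have [Eg1 EQ] : g1 = x + y - g /\ Q = x + y by split; lra.
have paradoxE : (T < U) = (c2 * g < (c1 + c2) * y).
  by rewrite -subr_gt0 -[RHS]subr_gt0 U1 T1 Eg1 EQ; congr (0 < _); ring.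
have P2_slow : (c1 + c2 + c4 + c5) * y <= (c2 + c5) * g.
  rewrite Eg1 EQ in U1; lra.
have Q_mu2 : Q <= ((a4 - (a1 + a3)) * (c2 + c5) + (a4 + a5 - (a1 + a2)) * c3)
    / (c1 * (c2 + c5) + c3 * (c1 + c2)).
  rewrite ler_pdivlMr; last by rewrite !(addr_gt0, mulr_gt0).
  rewrite Dbar Dy Dg -subr_ge0.
  (* This product is exactly the numerator of [mu2] minus [Q] times its denominator. *)
  have : 0 <= (c2 + c3 + c5) * ((c2 + c5) * g - (c1 + c2 + c4 + c5) * y).
    by rewrite mulr_ge0 ?subr_ge0 // ltW // !addr_gt0.
  rewrite Eg1 EQ; lra.
have c12_gt0 := addr_gt0 c1_gt0 c2_gt0; have c45_gt0 := addr_gt0 c4_gt0 c5_gt0.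
have c35_gt0 := addr_gt0 c3_gt0 c5_gt0; have s_gt0 := addr_gt0 c12_gt0 c45_gt0.
have c235_gt0 := addr_gt0 c2_gt0 c35_gt0.
rewrite Q_mu2 andbT !gt_max (ltr_pdivrMr _ _ c12_gt0) (ltr_pdivrMr _ _ c45_gt0).
rewrite (ltr_pdivrMr _ _ c35_gt0) (ltr_pdivrMr _ _ c2_gt0) paradoxE Dy Dg.
(* Cleared of denominators, the first four bounds say in turn that [y], [x], [g1] and [g] are
   positive, up to a positive factor. *)
have -> : (c1 + c2) * x - (c4 + c5) * y < Q * (c1 + c2).
  have := mulr_gt0 s_gt0 y_gt0; rewrite EQ; lra.
have -> : - ((c1 + c2) * x - (c4 + c5) * y) < Q * (c4 + c5).
  have := mulr_gt0 s_gt0 x_gt0; rewrite EQ; lra.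
have -> : (c3 + c5) * g - c2 * g1 < Q * (c3 + c5).
  have := mulr_gt0 c235_gt0 g1_gt0; rewrite -gQ; lra.
have -> : - ((c3 + c5) * g - c2 * g1) < Q * c2.
  have := mulr_gt0 c235_gt0 g_gt0; rewrite -gQ; lra.
rewrite !andTb.
set B := _ - _; set C := (X in X / B).
(* The fifth bound has the sign of the paradox inequality, provided that dividing by [B] preserves
   order. *)
have BC : B * Q - C =
    (c2 + c3 + c5) * (c1 + c2 + c4 + c5) * ((c1 + c2) * y - c2 * g).
  by rewrite /B /C Eg1 EQ; ring.
have boundE : 0 < B -> (C / B < Q) = (c2 * g < (c1 + c2) * y).
  move=> B_gt0; rewrite ltr_pdivrMr // mulrC -subr_gt0 BC pmulr_rgt0 ?subr_gt0 //.
  by rewrite mulr_gt0 // !addr_gt0.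
split=> [paradox|[/boundE->]] //.
suff B_gt0 : 0 < B by rewrite boundE.
(* Scaling [paradox] by the sum of the four coefficients and [P2_slow] by [c1 + c2] lets them chain;
   then [g] cancels. *)
have : c2 * (c1 + c2 + c4 + c5) < (c1 + c2) * (c2 + c5).
  have h1 : (c1 + c2 + (c4 + c5)) * (c2 * g)
      < (c1 + c2 + (c4 + c5)) * ((c1 + c2) * y) by rewrite ltr_pM2l.
  have h2 : (c1 + c2) * ((c1 + c2 + c4 + c5) * y)
      <= (c1 + c2) * ((c2 + c5) * g) by rewrite ler_pM2l.
  rewrite -(ltr_pM2r g_gt0); lra.
rewrite -(ltr_pM2l c2_gt0) => h.
(* [B] is split into a positive polynomial and [c2] times the gap just found. *)
have -> : B = (c1 + c2) * ((c1 + c2) * c3 + c1 * (c2 + c5))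
    + (c2 * ((c1 + c2) * (c2 + c5)) - c2 * (c2 * (c1 + c2 + c4 + c5))).
  by rewrite /B; ring.
by rewrite addr_gt0 ?subr_gt0 // !(addr_gt0, mulr_gt0).
Qed.
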